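(* For any connected weighted graph $G=(V,E,\{w_e\}_{e\in E})$ with $|V|\geq 2$, $$\mathsf{T}_{\mathrm{IP}(2,G)}(1/4)\;\leq\; 20000\;\mathsf{T}_{\mathrm{RW}(G)}(1/4).$$
   Context: A weighted graph is a triple $G=(V,E,\{w_e\}_{e\in E})$ where $V$ is a finite nonempty set, $E$ is a set of two-element subsets of $V$, and $w_e>0$ for each $e\in E$. For $e=\{a,b\}\in E$ let $f_e:V\to V$ be the transposition exchanging $a$ and $b$ and fixing all other vertices. $(V)_2$ is the set of ordered pairs $\mathbf{x}=(\mathbf{x}(1),\mathbf{x}(2))$ of distinct elements of $V$, and $f_e(\mathbf{x})=(f_e(\mathbf{x}(1)),f_e(\mathbf{x}(2)))$. $\mathrm{RW}(G)$ is the continuous-time Markov chain on $V$ in which, for each $e\in E$, the state $u$ jumps to $f_e(u)$ at rate $w_e$. $\mathrm{IP}(2,G)$ (the two-particle interchange process) is the continuous-time Markov chain on $(V)_2$ in which, for each $e\in E$, the state $\mathbf{x}$ jumps to $f_e(\mathbf{x})$ at rate $w_e$. The total variation distance between probability measures on a finite set $S$ is $d_{\mathrm{TV}}(\mu,\nu)=\max_{A\subset S}(\mu(A)-\nu(A))$. For an irreducible continuous-time Markov chain $Q$ on a finite set $S$ with transition probabilities $q_t(s,s')$ and stationary distribution $\pi$, the $\varepsilon$-mixing time is $\mathsf{T}_Q(\varepsilon)=\inf\{t\geq 0:\max_{s\in S}d_{\mathrm{TV}}(q_t(s,\cdot),\pi)\leq\varepsilon\}$. *)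

(* Defs.v *)
From HB Require Import structures.
From mathcomp Require Import all_boot all_order all_algebra fingroup perm.
From mathcomp Require Import all_classical all_reals all_analysis.

Set Implicit Arguments.
Unset Strict Implicit.
Unset Printing Implicit Defensive.

Import Order.TTheory GRing.Theory Num.Theory.
Import numFieldNormedType.Exports.

Local Open Scope classical_set_scope.
Local Open Scope ring_scope.

(** * Finite-state continuous-time Markov chains

A chain on [S] is given by its jump rates [rate : S -> S -> R]; the diagonal
values [rate x x] are irrelevant, since a jump from [x] to [x] changes nothing. *)

Section MarkovChain.
Context {R : realType} {S : finType}.
Implicit Types (rate : S -> S -> R) (mu nu : S -> R) (t eps : R).

Definition generator rate (x y : S) : R :=
  if x == y then - \sum_(z | z != x) rate x z else rate x y.

(* Matrices are indexed by ordinals: index [i] stands for [enum_val i : S]. *)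
Definition generator_mx rate : 'M[R]_#|S| :=
  \matrix_(i, j) generator rate (enum_val i) (enum_val j).

(* The [(x, y)] entry of the matrix exponential of [t *: generator_mx rate]. *)
Definition trans_prob rate t (x y : S) : R :=
  limn (series (fun k : nat =>
    t ^+ k / k`!%:R * (generator_mx rate ^+ k) (enum_rank x) (enum_rank y))).

Definition is_prob mu : Prop := (forall x, 0 <= mu x) /\ \sum_x mu x = 1.

Definition is_stationary rate mu : Prop :=
  is_prob mu /\
  forall t, 0 <= t -> forall y, \sum_x mu x * trans_prob rate t x y = mu y.

(* An arbitrary stationary distribution; it is unique when the chain is
   irreducible, the only case in which it is meant to be used. *)
Definition stationary rate : S -> R :=
  xget (fun=> 0) [set mu | is_stationary rate mu].

(* The empty event contributes [0], so the base value [0] is harmless. *)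
Definition dTV mu nu : R :=
  \big[Num.max/0]_(A : {set S}) (\sum_(x in A) mu x - \sum_(x in A) nu x).

Definition worst_dTV rate t : R :=
  \big[Num.max/0]_(x : S) dTV (trans_prob rate t x) (stationary rate).

(* Extended-real infimum, so that the infimum of the empty set is [+oo]. *)
Definition mixing_time rate eps : \bar R :=
  ereal_inf [set t%:E | t in [set t : R | 0 <= t /\ worst_dTV rate t <= eps]].

End MarkovChain.

(** * Weighted graphs *)

(* The values of [weight] outside [edge] are never used. *)
Record wgraph (R : realType) := WGraph {
  vertex : finType;
  edge : {set {set vertex}};
  weight : {set vertex} -> R;
  vertex_gt0 : (0 < #|vertex|)%N;
  card_edge : forall e, e \in edge -> #|e| = 2%N;
  weight_gt0 : forall e, e \in edge -> 0 < weight e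
}.

Definition adj (R : realType) (G : wgraph R) : rel (vertex G) :=
  fun u v => [set u; v]%SET \in edge G.

Definition connected_graph (R : realType) (G : wgraph R) : Prop :=
  forall u v : vertex G, connect (@adj R G) u v.

Section Moves.
Context {V : finType}.

(* Independent of the order in which [enum] lists the two endpoints. *)
Definition edge_swap (e : {set V}) : {perm V} :=
  if enum e is [:: a; b] then tperm a b else 1%g.

Lemma edge_swapE (a b : V) : a != b -> edge_swap [set a; b]%SET = tperm a b.
Proof.
move=> ab; rewrite /edge_swap.
have : perm_eq (enum [set a; b]%SET) [:: a; b].
  apply: uniq_perm; rewrite ?enum_uniq //= ?inE ?andbT //.
  by move=> x; rewrite mem_enum !inE.
have : size (enum [set a; b]%SET) = 2%N by rewrite -cardE cards2 ab.
case: (enum _) => [|c [|d []]] //= _ /perm_mem cd.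
have := cd a; have := cd b; rewrite !inE !eqxx !orbT /= => cb ca.
case/orP: ca ab cb => /eqP -> ab /orP[] /eqP eb.
- by rewrite eb eqxx in ab.
- by rewrite eb.
- by rewrite eb tpermC.
- by rewrite eb eqxx in ab.
Qed.

Definition pair2 := {x : V * V | x.1 != x.2}.

Lemma pair2_move_subproof (s : {perm V}) (x : pair2) :
  s (val x).1 != s (val x).2.
Proof. by rewrite (inj_eq perm_inj) (valP x). Qed.

Definition pair2_move (s : {perm V}) (x : pair2) : pair2 :=
  exist _ (s (val x).1, s (val x).2) (pair2_move_subproof s x).

End Moves.
Arguments pair2 : clear implicits.

(** * The random walk and the two-particle interchange process *)

Definition RW (R : realType) (G : wgraph R) (u v : vertex G) : R :=
  \sum_(e in edge G | edge_swap e u == v) weight e.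

Definition IP2 (R : realType) (G : wgraph R) (x y : pair2 (vertex G)) : R :=
  \sum_(e in edge G | pair2_move (edge_swap e) x == y) weight e.

Arguments RW {R} G u v.
Arguments IP2 {R} G x y.

(* Main.v *)
Require Import Defs.
From mathcomp Require Import all_boot all_order all_algebra fingroup perm.
From mathcomp Require Import all_classical all_reals all_analysis.
From mathcomp Require Import ring lra.

(** Two exchanging particles at x, y move like two independent walks, except that
    across the edge xy they swap places instead of jumping onto each other. Let
    m t x y be the probability that independent walks from x, y meet before t.

    Before meeting, the exchanging pair and the independent pair agree, so
    their laws at time t differ by at most m t x y. As a kernel, m t is
    positive definite (first-meeting decomposition), and on positive definite
    functions the independent pair dominates the exchanging pair, as in
    Liggett's comparison; so under the exchange process the expectation of m t
    is at most its expectation for independent walks.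

    Let T be a mixing time of the walk. Either m (5 T) has small expectation after
    independent walks have run for 6 T, and then the exchanging pair is
    mixed at time 11 T because it is close to an independent pair; or independent
    walks meet within 11 T with probability at least 1/16 from every starting
    pair, hence with probability at least 7/8 within 528 T. In the latter case
    a difference phi(x, z) - phi(y, z), antisymmetric in x and y, decays as if
    killed when x and y meet, since an exchange of x and y that does or does
    not happen produces cancelling contributions. All comparisons are instances
    of the maximum principle for linear equations of jump type. *)

Set Implicit Arguments.
Unset Strict Implicit.
Unset Printing Implicit Defensive.

Import Order.TTheory GRing.Theory Num.Theory.
Import numFieldNormedType.Exports.

Local Open Scope classical_set_scope.
Local Open Scope ring_scope.

(** * Exponential series and matrix exponentials *)

Section PointwiseDerivatives.
Context {R : realType}.
Implicit Types (f g : R -> R) (t df dg : R).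

Lemma is_derive_add f g t df dg : is_derive t 1 f df -> is_derive t 1 g dg ->
  is_derive t 1 (fun s => f s + g s) (df + dg).
Proof. exact: is_deriveD. Qed.

Lemma is_derive_sub f g t df dg : is_derive t 1 f df -> is_derive t 1 g dg ->
  is_derive t 1 (fun s => f s - g s) (df - dg).
Proof. exact: is_deriveB. Qed.

Lemma is_derive_csub f t df (a : R) : is_derive t 1 f df ->
  is_derive t 1 (fun s => a - f s) (- df).
Proof. by move=> Df; have := is_derive_sub (is_derive_cst a t 1) Df; rewrite sub0r. Qed.

Lemma is_derive_mul f g t df dg : is_derive t 1 f df -> is_derive t 1 g dg ->
  is_derive t 1 (fun s => f s * g s) (df * g t + f t * dg).
Proof.
move=> Df Dg; have := is_deriveM Df Dg.
by rewrite /GRing.scale /= addrC [g t * df]mulrC.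
Qed.

Lemma is_derive_mulc f t df (a : R) : is_derive t 1 f df ->
  is_derive t 1 (fun s => a * f s) (a * df).
Proof. exact: (@is_deriveZ _ R^o R^o f a). Qed.

Lemma is_derive_shiftl f t df (a : R) : is_derive (a + t) 1 f df ->
  is_derive t 1 (fun s => f (a + s)) df.
Proof.
move=> Df; have Da := is_derive_add (is_derive_cst a t 1) (is_derive_id t 1).
by have := is_derive1_comp Df Da; rewrite add0r mulr1.
Qed.

Lemma is_derive_reflect f t df (a : R) : is_derive (a - t) 1 f df ->
  is_derive t 1 (fun s => f (a - s)) (- df).
Proof.
move=> Df; have Da := is_derive_sub (is_derive_cst a t 1) (is_derive_id t 1).
by have := @is_derive1_comp _ f (fun s => a - s) _ _ _ Df Da; rewrite sub0r mulrN1.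
Qed.

End PointwiseDerivatives.

Lemma is_derive_bigsum (R : realType) (I : Type) (s : seq I) (P : pred I)
    (h : I -> R -> R) (dh : I -> R) (t : R) :
  (forall i, P i -> is_derive t 1 (h i) (dh i)) ->
  is_derive t 1 (fun u => \sum_(i <- s | P i) h i u) (\sum_(i <- s | P i) dh i).
Proof.
move=> H; elim: s => [|i s IH].
  rewrite big_nil (_ : (fun _ => _) = cst 0); first exact: is_derive_cst.
  by apply/funext => u; rewrite big_nil.
rewrite big_cons; case: ifPn => Pi; last first.
  rewrite (_ : (fun _ => _) = fun u => \sum_(j <- s | P j) h j u) //.
  by apply/funext => u; rewrite big_cons (negbTE Pi).
rewrite (_ : (fun _ => _) = h i + (fun u => \sum_(j <- s | P j) h j u)).
  by apply: is_deriveD; exact: H.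
by apply/funext => u; rewrite big_cons Pi.
Qed.

Lemma cvg_bigsum (R : realType) (I : Type) (s : seq I) (P : pred I)
    (u : I -> nat -> R) (l : I -> R) :
  (forall i, P i -> u i @ \oo --> l i) ->
  (\sum_(i <- s | P i) u i) @ \oo --> \sum_(i <- s | P i) l i.
Proof.
move=> ul; apply: (big_ind2 (fun (v : nat -> R) m => v @ \oo --> m)) => //.
  exact: cvg_cst.
by move=> *; exact: cvgD.
Qed.

(** * Termwise differentiation of exponential generating series *)

Section ExponentialSeries.
Context {R : realType}.
Implicit Types (a : nat -> R) (C t : R).

Definition exp_series a t := limn (series (fun k => t ^+ k / k`!%:R * a k)).

Let egf a k : R := a k / k`!%:R.

Let exp_seriesE a : exp_series a = fun t => limn (pseries (egf a) t).
Proof.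
apply/funext => t; rewrite /exp_series /pseries; congr (limn (series _)).
by apply/funext => k; rewrite /egf /=; ring.
Qed.

Let egf_diffs a : pseries_diffs (egf a) = egf (fun k => a k.+1).
Proof.
apply/funext => k; rewrite /pseries_diffs /egf factS natrM invfM.
by field; rewrite ?pnatr_eq0 -?lt0n ?fact_gt0 // addrC natr1 pnatr_eq0.
Qed.

Let is_cvg_egf a C t : 0 <= C -> (forall k, `|a k| <= C ^+ k) ->
  cvgn (pseries (egf a) t).
Proof.
move=> C0 aC; apply: normed_cvg.
apply: (@series_le_cvg _ _ (exp_coeff (C * `|t|))) => [k|k|k|].
- exact: normr_ge0.
- by rewrite exp_coeff_ge0 // mulr_ge0.
- rewrite /egf /exp_coeff /= !normrM exprMn normrX [`|_^-1|]ger0_norm ?invr_ge0 //.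
  have := aC k; have : 0 <= `|t| ^+ k by rewrite exprn_ge0.
  have : 0 <= k`!%:R^-1 :> R by rewrite invr_ge0.
  move=> f0 tk0 ak; rewrite [leLHS]mulrAC.
  by apply: ler_wpM2r => //; apply: ler_wpM2r.
- exact: is_cvg_series_exp_coeff.
Qed.

Lemma is_cvg_exp_series a C t : 0 <= C -> (forall k, `|a k| <= C ^+ k) ->
  cvgn (series (fun k => t ^+ k / k`!%:R * a k)).
Proof.
move=> C0 aC; rewrite (_ : series _ = pseries (egf a) t).
  exact: is_cvg_egf aC.
by rewrite /pseries; congr (series _); apply/funext => k; rewrite /egf /=; ring.
Qed.

Lemma is_derive_exp_series a C t : 0 <= C -> (forall k, `|a k| <= C ^+ k) ->
  is_derive t 1 (exp_series a) (exp_series (fun k => a k.+1) t).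
Proof.
move=> C0 aC; rewrite !exp_seriesE -egf_diffs.
(* Termwise differentiation needs the series and its first two formal derivatives to converge beyond
   [t]. These are series of shifted sequences, bounded by [D ^+ j * D ^+ k]; since [D] is nonzero,
   dividing by [D ^+ j] brings them back to the geometric bound. *)
pose D := C + 1.
have D0 : 0 <= D by rewrite addr_ge0.
have aD j k : `|a (k + j)%N| <= D ^+ j * D ^+ k.
  rewrite -exprD addnC; apply: le_trans (aC _) _.
  by apply: lerXn2r; rewrite ?nnegrE // lerDl.
have cvgj j : cvgn (pseries (egf (fun k => a (k + j)%N)) (`|t| + 1)).
  have -> : egf (fun k => a (k + j)%N) =
            fun k => D ^+ j * egf (fun k => a (k + j)%N / D ^+ j) k.
    apply/funext => k; rewrite /egf.
    have Dj : D ^+ j != 0 by rewrite expf_neq0 // gt_eqF // ltr_wpDl.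
    by field; rewrite Dj andbT pnatr_eq0 -lt0n fact_gt0.
  have -> : pseries (fun k => D ^+ j * egf (fun k => a (k + j)%N / D ^+ j) k) (`|t| + 1)
     = D ^+ j *: pseries (egf (fun k => a (k + j)%N / D ^+ j)) (`|t| + 1).
    apply/funext => n; rewrite /pseries /series /=.
    under eq_bigr do rewrite -mulrA.
    by rewrite -mulr_sumr.
  apply: is_cvgZr; apply: (@is_cvg_egf _ D) => // k.
  have Dj : 0 < D ^+ j by rewrite exprn_gt0 // ltr_wpDl.
  by rewrite normrM normfV (ger0_norm (ltW Dj)) ler_pdivrMr // mulrC.
apply: (@pseries_snd_diffs _ _ (`|t| + 1)).
- have := cvgj 0%N; rewrite (_ : (fun k => _) = a) //; apply/funext => k; by rewrite addn0.
- rewrite egf_diffs (_ : (fun k => _) = fun k => a (k + 1)%N) //.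
  by apply/funext => k; rewrite addn1.
- rewrite !egf_diffs (_ : (fun k => _) = fun k => a (k + 2)%N) //.
  by apply/funext => k; rewrite addn2.
- by rewrite [ltRHS]ger0_norm ?addr_ge0 // ltrDl.
Qed.

Lemma exp_series0 a : exp_series a 0 = a 0%N.
Proof.
rewrite /exp_series; apply: cvg_lim => //; apply: (@cvg_near_cst _ _ _ _ _ _).
(* Partial sums at 0 are constant only from index 1 on: the one of index 0 is empty. *)
exists 1%N => // -[//|n] _ /=; rewrite /series /= big_nat_recl // big1 => [|k _].
  by rewrite expr0 fact0 divr1 mul1r addr0.
by rewrite exprS !mul0r.
Qed.

Lemma exp_series_ge0 a C t : 0 <= C -> (forall k, `|a k| <= C ^+ k) ->
  0 <= t -> (forall k, 0 <= a k) -> 0 <= exp_series a t.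
Proof.
move=> C0 aC t0 a0; apply: limr_ge; first exact: is_cvg_exp_series aC.
apply: nearW => n; rewrite /series /=; apply: sumr_ge0 => k _.
by rewrite mulr_ge0 // mulr_ge0 ?invr_ge0 // exprn_ge0.
Qed.

Lemma exp_series_sum (I : finType) (b : I -> R) (a : I -> nat -> R) C t :
  0 <= C -> (forall i k, `|a i k| <= C ^+ k) ->
  exp_series (fun k => \sum_i b i * a i k) t = \sum_i b i * exp_series (a i) t.
Proof.
move=> C0 aC; rewrite /exp_series; apply: cvg_lim => //.
have -> : series (fun k => t ^+ k / k`!%:R * (\sum_i b i * a i k)) =
    \sum_i (fun n => b i * series (fun k => t ^+ k / k`!%:R * a i k) n).
  apply/funext => n; rewrite fct_sumE /series /=.
  under eq_bigr do rewrite mulr_sumr.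
  rewrite exchange_big /=; apply: eq_bigr => i _; rewrite mulr_sumr.
  by apply: eq_bigr => k _; ring.
apply: cvg_bigsum => i _.
by apply: cvgMl_tmp; exact: is_cvg_exp_series (aC i).
Qed.

End ExponentialSeries.

(** The sum of all absolute entries works as [C], because it dominates every absolute row sum. *)
Lemma expmx_entry_bound (R : realType) n (M : 'M[R]_n) :
  exists2 C, 0 <= C & forall k i j, `|(M ^+ k) i j| <= C ^+ k.
Proof.
exists (\sum_i \sum_j `|M i j|).
  by apply: sumr_ge0 => i _; apply: sumr_ge0.
elim=> [|k IH] i j.
  by rewrite expr0 mxE; case: (_ == _); rewrite ?normr1 ?normr0.
rewrite exprS -[M * _]/(M *m _) mxE.
apply: le_trans (ler_norm_sum _ _ _) _; rewrite exprS.
apply: (@le_trans _ _ ((\sum_l `|M i l|) * (\sum_i \sum_j `|M i j|) ^+ k)).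
  rewrite mulr_suml; apply: ler_sum => l _.
  by rewrite normrM ler_wpM2l.
apply: ler_wpM2r; first by rewrite exprn_ge0 // sumr_ge0 // => ? _; rewrite sumr_ge0.
by rewrite [leRHS](bigD1 i) //= lerDl sumr_ge0 // => ? _; rewrite sumr_ge0.
Qed.

(** * Backward and forward equations of a matrix exponential *)

Section KernelExponential.
Context {R : realType} {S : finType}.
Implicit Types (B : S -> S -> R) (t : R) (x y z : S).

Definition kernel_mx B : 'M[R]_#|S| :=
  \matrix_(i, j) B (enum_val i) (enum_val j).

Definition kexp B t x y : R :=
  exp_series (fun k => (kernel_mx B ^+ k) (enum_rank x) (enum_rank y)) t.

Let reindex_rank (F : 'I_#|S| -> R) : \sum_l F l = \sum_z F (enum_rank z).
Proof. exact: (reindex _ (onW_bij _ (@enum_rank_bij S))). Qed.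

Lemma kexp0 B x y : kexp B 0 x y = (x == y)%:R.
Proof. by rewrite /kexp exp_series0 expr0 mxE (inj_eq enum_rank_inj). Qed.

Lemma kexp_ge0 B t x y : (forall x y, 0 <= B x y) -> 0 <= t -> 0 <= kexp B t x y.
Proof.
move=> B0 t0; have [C C0 HC] := expmx_entry_bound (kernel_mx B).
apply: (exp_series_ge0 C0 _ t0) => [k|k]; first exact: HC.
elim: k (enum_rank x) => [|k IH] i; first by rewrite expr0 mxE ler0n.
rewrite exprS -[kernel_mx B * _]/(kernel_mx B *m _) mxE.
by apply: sumr_ge0 => l _; rewrite mulr_ge0 // mxE.
Qed.

Lemma is_derive_kexpl B t x y :
  is_derive t 1 (fun s => kexp B s x y) (\sum_z B x z * kexp B t z y).
Proof.
have [C C0 HC] := expmx_entry_bound (kernel_mx B).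
rewrite /kexp -(exp_series_sum _ _ C0); last by move=> *; exact: HC.
have <- : (fun k => (kernel_mx B ^+ k.+1) (enum_rank x) (enum_rank y)) =
    fun k => \sum_z B x z * (kernel_mx B ^+ k) (enum_rank z) (enum_rank y).
  apply/funext => k; rewrite exprS -[kernel_mx B * _]/(kernel_mx B *m _) mxE.
  by rewrite reindex_rank; apply: eq_bigr => z _; rewrite mxE !enum_rankK.
exact: (is_derive_exp_series t C0 (fun k => HC k _ _)).
Qed.

Lemma is_derive_kexpr B t x y :
  is_derive t 1 (fun s => kexp B s x y) (\sum_z B z y * kexp B t x z).
Proof.
have [C C0 HC] := expmx_entry_bound (kernel_mx B).
rewrite /kexp -(exp_series_sum _ _ C0); last by move=> *; exact: HC.
have <- : (fun k => (kernel_mx B ^+ k.+1) (enum_rank x) (enum_rank y)) =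
    fun k => \sum_z B z y * (kernel_mx B ^+ k) (enum_rank x) (enum_rank z).
  apply/funext => k; rewrite exprSr -[_ * kernel_mx B]/(_ *m kernel_mx B) mxE.
  by rewrite reindex_rank; apply: eq_bigr => z _; rewrite mxE !enum_rankK mulrC.
exact: (is_derive_exp_series t C0 (fun k => HC k _ _)).
Qed.

End KernelExponential.

(** Passes from rates aggregated by target state, as in [RW] and [IP2], to one term per jump. *)
Lemma sum_jump (R : realType) (S I : finType) (P : pred I) (a : I -> R)
    (h : I -> S) (f : S -> R) :
  \sum_z (\sum_(i | P i && (h i == z)) a i) * f z = \sum_(i | P i) a i * f (h i).
Proof.
rewrite (partition_big h xpredT) //=; apply: eq_bigr => z _.
by rewrite mulr_suml; apply: eq_bigr => i /andP[_ /eqP ->].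
Qed.

Lemma is_derive_ge0_le (R : realType) (f df : R -> R) (a b : R) :
  a <= b -> (forall x : R, is_derive x 1 f (df x)) ->
  (forall x, a <= x <= b -> 0 <= df x) -> f a <= f b.
Proof.
move=> ab Hf Hdf.
have dv x : derivable f x 1 by have [] := Hf x.
apply: (@ger0_derive1_ndecr _ f a b) => // [x xab|].
  have [_] := Hf x; rewrite derive1E => ->.
  by apply: Hdf; move: xab; rewrite in_itv /= => /andP[/ltW -> /ltW ->].
by apply: derivable_within_continuous => x _.
Qed.

(** * Maximum principle for jump equations *)

Section JumpEquation.
Context {R : realType} {S I : finType}.
Variables (P : pred I) (w : I -> S -> R) (g : I -> S -> S) (c : S -> R).

Lemma jump_equation_exists (u0 : S -> R) : exists u : R -> S -> R,
  u 0 =1 u0 /\ forall (s : R) x, is_derive s 1 (fun s => u s x)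
    (\sum_(i | P i) w i x * u s (g i x) - c x * u s x).
Proof.
pose B x y := \sum_(i | P i && (g i x == y)) w i x - (x == y)%:R * c x.
exists (fun s x => \sum_y u0 y * kexp B s x y); split=> [x|s x].
  rewrite (bigD1 x) //= kexp0 eqxx mulr1 big1 ?addr0 // => y yx.
  by rewrite kexp0 eq_sym (negbTE yx) mulr0.
have -> : \sum_(i | P i) w i x * (\sum_y u0 y * kexp B s (g i x) y)
  - c x * (\sum_y u0 y * kexp B s x y) =
  \sum_y u0 y * (\sum_z B x z * kexp B s z y).
  under [RHS]eq_bigr => y _ do rewrite /B.
  under [RHS]eq_bigr => y _.
    rewrite (_ : \sum_z _ = \sum_(i | P i) w i x * kexp B s (g i x) y
                           - c x * kexp B s x y); last first.
      under eq_bigr do rewrite mulrBl.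
      rewrite sumrB sum_jump; congr (_ - _).
      rewrite (bigD1 x) //= eqxx mul1r big1 ?addr0 // => z zx.
      by rewrite eq_sym (negbTE zx) !mul0r.
    rewrite mulrBr mulr_sumr; over.
  rewrite sumrB exchange_big /= mulr_sumr; congr (_ - _); last first.
    by apply: eq_bigr => y _; ring.
  by apply: eq_bigr => i _; rewrite mulr_sumr; apply: eq_bigr => y _; ring.
apply: is_derive_bigsum => y _.
exact: is_derive_mulc (is_derive_kexpl B s x y).
Qed.

(** For systems of particles, [D] will be the set of tuples with distinct entries. Transpositions
    preserve it, and the equations hold only there. *)
Variable D : pred S.
Hypothesis w_ge0 : forall i x, P i -> D x -> 0 <= w i x.
Hypothesis g_stable : forall i x, P i -> D x -> D (g i x).

(* With [B] the nonnegative kernel obtained by adding a large multiple [C] of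
   the identity, [s |-> \sum_y kexp B (t - s) x y * expR (C * s) * u s y] is
   nondecreasing on [0, t]. *)
Lemma jump_equation_ge0 (u r : R -> S -> R) :
  (forall x, D x -> 0 <= u 0 x) ->
  (forall (s : R) x, 0 <= s -> D x -> 0 <= r s x) ->
  (forall (s : R) x, D x -> is_derive s 1 (fun s => u s x)
    (\sum_(i | P i) w i x * u s (g i x) - c x * u s x + r s x)) ->
  forall (t : R) x, 0 <= t -> D x -> 0 <= u t x.
Proof.
move=> u0 r0 du t x t0 Dx.
pose C : R := \sum_y `|c y|.
have Cc y : 0 <= C - c y.
  rewrite subr_ge0; apply: le_trans (ler_norm _) _.
  by rewrite /C (bigD1 y) //= lerDl sumr_ge0.
(* [B] and [v] vanish outside [D], so sums over all of [S] see only states where the hypotheses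
   apply. *)
pose B y z : R := if D y then
  \sum_(i | P i && (g i y == z)) w i y + (y == z)%:R * (C - c y) else 0.
have B0 y z : 0 <= B y z.
  rewrite /B; case: ifP => // Dy; rewrite addr_ge0 ?mulr_ge0 //.
  by apply: sumr_ge0 => i /andP[Pi _]; exact: w_ge0.
pose v (s : R) y : R := if D y then expR (C * s) * u s y else 0.
pose dv (s : R) y : R := \sum_z B y z * v s z + (if D y then expR (C * s) * r s y else 0).
have derv (s : R) y : is_derive s 1 (fun s => v s y) (dv s y).
  rewrite /v /dv; case: ifPn => Dy; last first.
    rewrite addr0 big1 => [|z _]; last by rewrite /B (negbTE Dy) mul0r.
    exact: is_derive_cst.
  rewrite /B Dy; under eq_bigr do rewrite mulrDl.
  rewrite big_split /= sum_jump (bigD1 y) //= eqxx mul1r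
    [X in _ + (_ + X) + _]big1 => [|z zy].
    rewrite addr0.
    have de : is_derive s 1 (fun s => expR (C * s)) (C * expR (C * s)).
      have dC := is_derive_mulc C (is_derive_id s 1).
      by have := is_derive1_comp (is_derive_expR (C * s)) dC; rewrite mulr1 mulrC.
    apply: (is_derive_eq (is_derive_mul de (du s y Dy))).
    rewrite mulrDr mulrBr mulr_sumr.
    rewrite (_ : \sum_(i | P i) w i y * 
          (if D (g i y) then expR (C * s) * u s (g i y) else 0) = \sum_(i | P i) expR (C * s) * (w i y * u s (g i y))); first by rewrite /v Dy; ring.
    by apply: eq_bigr => i Pi; rewrite g_stable //; ring.
  by rewrite eq_sym (negbTE zy) !mul0r.
pose G (s : R) : R := \sum_y kexp B (t - s) x y * v s y.
pose dG (s : R) : R := \sum_y (kexp B (t - s) x y * dv s y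
                     - (\sum_z B z y * kexp B (t - s) x z) * v s y).
have derG (s : R) : is_derive s 1 G (dG s).
  apply: is_derive_bigsum => y _.
  have dk := is_derive_reflect (is_derive_kexpr B (t - s) x y).
  apply: (is_derive_eq (is_derive_mul dk (derv s y))).
  by ring.
(* In [dG] the two terms containing [B] cancel after exchanging summations; only the source remains,
   weighted by a nonnegative kernel. *)
have : G 0 <= G t.
  apply: is_derive_ge0_le t0 derG _ => s /andP[s0 st].
  rewrite /dG sumrB.
  have -> : \sum_y (\sum_z B z y * kexp B (t - s) x z) * v s y =
            \sum_y kexp B (t - s) x y * (\sum_z B y z * v s z).
    under eq_bigr do rewrite mulr_suml.
    rewrite exchange_big /=; apply: eq_bigr => z _; rewrite mulr_sumr.
    by apply: eq_bigr => y _; ring.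
  rewrite -sumrB; apply: sumr_ge0 => y _; rewrite -mulrBr mulr_ge0 //.
    by rewrite kexp_ge0 // subr_ge0.
  rewrite /dv addrAC subrr add0r; case: ifP => // Dy.
  by rewrite mulr_ge0 ?expR_ge0 ?r0.
have -> : G t = expR (C * t) * u t x.
  rewrite /G (bigD1 x) //= subrr kexp0 eqxx mul1r big1 => [|y yx].
    by rewrite addr0 /v Dx.
  by rewrite kexp0 eq_sym (negbTE yx) mul0r.
move=> G0t; rewrite -(pmulr_rge0 _ (expR_gt0 (C * t))); apply: le_trans G0t.
apply: sumr_ge0 => y _; rewrite subr0 mulr_ge0 ?kexp_ge0 //.
by rewrite /v; case: ifP => // Dy; rewrite mulr_ge0 ?expR_ge0 ?u0.
Qed.

End JumpEquation.

(** * Chains driven by random bijections *)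

Section JumpChain.
Context {R : realType} {S I : finType}.
Variables (E : {set I}) (W : I -> R) (g : I -> S -> S).
Hypothesis W_ge0 : forall e, e \in E -> 0 <= W e.
Hypothesis g_inj : forall e, injective (g e).

Let rate x y : R := \sum_(e in E | g e x == y) W e.

(** Jumps that fix [x] enter the diagonal of [rate] but not of [generator]; on the right they
    contribute zero. *)
Lemma sum_generator (f : S -> R) x :
  \sum_y generator rate x y * f y = \sum_(e in E) W e * (f (g e x) - f x).
Proof.
under [RHS]eq_bigr do rewrite mulrBr.
rewrite sumrB -(sum_jump (fun e => e \in E) W (fun e => g e x) f) -mulr_suml.
rewrite (_ : \sum_(e in E) W e = \sum_y rate x y); last first.
  exact: (partition_big (fun e => g e x) xpredT).
rewrite -/(rate x) (bigD1 x) //= {1}/generator eqxx.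
rewrite [in RHS](bigD1 x) //= [\sum_y rate x y](bigD1 x) //=.
have -> : \sum_(y | y != x) generator rate x y * f y = \sum_(y | y != x) rate x y * f y.
  by apply: eq_bigr => y yx; rewrite /generator eq_sym (negbTE yx).
by rewrite -/(rate x x); ring.
Qed.

(** The transition semigroup, acting on functions. *)
Definition flow (f : S -> R) (t : R) x := \sum_y trans_prob rate t x y * f y.

Lemma flow0 f x : flow f 0 x = f x.
Proof.
rewrite /flow (bigD1 x) //= [trans_prob _ _ _ _]kexp0 eqxx mul1r big1 ?addr0 // => y yx.
by rewrite [trans_prob _ _ _ _]kexp0 eq_sym (negbTE yx) mul0r.
Qed.

Lemma is_derive_trans_prob (t : R) x y :
  is_derive t 1 (fun s => trans_prob rate s x y)
    (\sum_(e in E) W e * (trans_prob rate t (g e x) y - trans_prob rate t x y)).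
Proof.
rewrite -(sum_generator (fun z => trans_prob rate t z y)).
exact: (is_derive_kexpl (generator rate)).
Qed.

Lemma is_derive_flow f (t : R) x :
  is_derive t 1 (fun s => flow f s x)
    (\sum_(e in E) W e * (flow f t (g e x) - flow f t x)).
Proof.
rewrite -sum_generator.
rewrite (_ : \sum_y _ = \sum_y f y * (\sum_z generator rate x z * trans_prob rate t z y)).
  rewrite (_ : (fun s => flow f s x) = fun s => \sum_y f y * trans_prob rate s x y).
    apply: is_derive_bigsum => y _; apply: is_derive_mulc.
    exact: (is_derive_kexpl (generator rate)).
  by apply/funext => s; apply: eq_bigr => y _; rewrite mulrC.
under eq_bigr do rewrite mulr_sumr.
rewrite exchange_big /=; apply: eq_bigr => y _; rewrite mulr_sumr.
by apply: eq_bigr => z _; ring.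
Qed.

Lemma chain_equation_ge0 (u : R -> S -> R) :
  (forall x, 0 <= u 0 x) ->
  (forall (s : R) x, is_derive s 1 (fun s => u s x)
    (\sum_(e in E) W e * (u s (g e x) - u s x))) ->
  forall (t : R) x, 0 <= t -> 0 <= u t x.
Proof.
move=> u0 du t x t0.
have du' (s : R) y : predT y -> is_derive s 1 (fun s => u s y)
    (\sum_(e in E) W e * u s (g e y) - (\sum_(e in E) W e) * u s y + 0).
  move=> _; apply: (is_derive_eq (du s y)).
  under eq_bigr do rewrite mulrBr.
  by rewrite sumrB mulr_suml addr0.
apply: (jump_equation_ge0 _ _ _ _ du') => // e y Ee _; exact: W_ge0.
Qed.

Lemma chain_equation_unique (u v : R -> S -> R) :
  u 0 =1 v 0 ->
  (forall (s : R) x, is_derive s 1 (fun s => u s x)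
    (\sum_(e in E) W e * (u s (g e x) - u s x))) ->
  (forall (s : R) x, is_derive s 1 (fun s => v s x)
    (\sum_(e in E) W e * (v s (g e x) - v s x))) ->
  forall (t : R) x, 0 <= t -> u t x = v t x.
Proof.
move=> uv0; suff H : forall u v : R -> S -> R,
  u 0 =1 v 0 ->
  (forall (s : R) x, is_derive s 1 (fun s => u s x)
    (\sum_(e in E) W e * (u s (g e x) - u s x))) ->
  (forall (s : R) x, is_derive s 1 (fun s => v s x)
    (\sum_(e in E) W e * (v s (g e x) - v s x))) ->
  forall (t : R) x, 0 <= t -> u t x <= v t x.
  by move=> du dv t x t0; apply/le_anti; rewrite !H.
move=> {uv0}u' v' uv du dv t x t0; rewrite -subr_ge0.
apply: (chain_equation_ge0 (u := fun t x => v' t x - u' t x)) => // [y|s y].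
  by rewrite uv subrr.
apply: (is_derive_eq (is_derive_sub (dv s y) (du s y))).
by rewrite -sumrB; apply: eq_bigr => e _; ring.
Qed.

Lemma trans_prob_ge0 (t : R) x y : 0 <= t -> 0 <= trans_prob rate t x y.
Proof.
move=> t0; apply: (chain_equation_ge0 (u := fun t x => trans_prob rate t x y)) => //.
  by move=> z; rewrite [trans_prob _ _ _ _]kexp0.
by move=> s z; exact: is_derive_trans_prob.
Qed.

Lemma trans_prob_sum (t : R) x : 0 <= t -> \sum_y trans_prob rate t x y = 1.
Proof.
move=> t0; transitivity (flow (fun=> 1) t x).
  by apply: eq_bigr => y _; rewrite mulr1.
apply: (chain_equation_unique (v := fun _ _ => 1)) => //.
- by move=> y; rewrite flow0.
- by move=> s y; exact: is_derive_flow.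
- move=> s y; rewrite big1 => [|e _]; first exact: is_derive_cst.
  by rewrite subrr mulr0.
Qed.

Lemma flowD f (s t : R) x : 0 <= s -> flow f (t + s) x = flow (flow f t) s x.
Proof.
move=> s0; apply: (chain_equation_unique (u := fun s x => flow f (t + s) x)) => //.
- by move=> y; rewrite addr0 flow0.
- by move=> r y; apply: (is_derive_shiftl (f := fun s => flow f s y)); exact: is_derive_flow.
- by move=> r y; exact: is_derive_flow.
Qed.

Lemma flow_ge0 f (t : R) x : 0 <= t -> (forall y, 0 <= f y) -> 0 <= flow f t x.
Proof. by move=> t0 f0; apply: sumr_ge0 => y _; rewrite mulr_ge0 ?trans_prob_ge0. Qed.

Lemma flow_cst (a t : R) x : 0 <= t -> flow (fun=> a) t x = a.
Proof. by move=> t0; rewrite /flow -mulr_suml trans_prob_sum ?mul1r. Qed.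

Lemma flowB f h (t : R) x : flow (fun y => f y - h y) t x = flow f t x - flow h t x.
Proof. by rewrite /flow -sumrB; apply: eq_bigr => y _; rewrite mulrBr. Qed.

Lemma flow_le f h (t : R) x : 0 <= t -> (forall y, f y <= h y) ->
  flow f t x <= flow h t x.
Proof.
move=> t0 fh; rewrite -subr_ge0 -flowB flow_ge0 // => y.
by rewrite subr_ge0.
Qed.

(** Each [g e] permutes the finite state space, so reindexing makes the derivative of a column sum
    vanish. This makes the uniform distribution stationary. *)
Lemma trans_prob_colsum (t : R) y : 0 <= t -> \sum_x trans_prob rate t x y = 1.
Proof.
move=> t0; pose m (s : R) := \sum_x trans_prob rate s x y.
have dm (s : R) : is_derive s 1 m 0.
  have -> : 0 = \sum_x \sum_(e in E) W e *
      (trans_prob rate s (g e x) y - trans_prob rate s x y).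
    rewrite exchange_big big1 //= => e _; rewrite -mulr_sumr sumrB.
    by rewrite [X in _ - X](reindex_inj (@g_inj e)) subrr mulr0.
  by apply: is_derive_bigsum => x _; exact: is_derive_trans_prob.
rewrite -[LHS]/(m t) (is_derive_0_is_cst t 0 dm) /m (bigD1 y) //=.
rewrite [trans_prob _ _ _ _]kexp0 eqxx.
by rewrite big1 ?addr0 // => x xy; rewrite [trans_prob _ _ _ _]kexp0 (negbTE xy).
Qed.

(** The uniform distribution is a witness, so [xget] does not return its default value. *)
Lemma stationaryP : (0 < #|S|)%N -> is_stationary rate (stationary rate).
Proof.
move=> S0; apply: (@xgetPex _ (fun=> 0) [set mu | is_stationary rate mu]).
have S0' : #|S|%:R != 0 :> R by rewrite pnatr_eq0 -lt0n.
exists (fun=> #|S|%:R^-1); split=> [|t t0 y]; first split=> [x|].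
- by rewrite invr_ge0.
- by rewrite sumr_const -[_ *+ _]mulr_natr mulVf.
- by rewrite -mulr_sumr trans_prob_colsum // mulr1.
Qed.

(** The difference of two rows is a signed measure of total mass 0 whose positive part has mass at
    most [2 * eps]; it is integrated against [f] minus its minimum, which lies between 0 and [d]. *)
Lemma worst_dTV_flow (eps t : R) f (d : R) : (0 < #|S|)%N -> 0 <= t ->
  worst_dTV rate t <= eps ->
  (forall x y, f x - f y <= d) ->
  forall x y, flow f t x - flow f t y <= 2 * eps * d.
Proof.
move=> S0 t0 mixt fd x y.
have d0 : 0 <= d by have := fd x x; rewrite subrr.
have [[_ pi1] _] := stationaryP S0.
have tv z (A : {set S}) :
    \sum_(v in A) trans_prob rate t z v - \sum_(v in A) stationary rate v <= eps.
  apply: le_trans mixt; rewrite /worst_dTV.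
  apply: le_trans (le_bigmax _ _ z); rewrite /dTV.
  exact: (le_bigmax _ (fun A : {set S} => \sum_(v in A) trans_prob rate t z v
                            - \sum_(v in A) stationary rate v) A).
pose nu z := trans_prob rate t x z - trans_prob rate t y z.
pose A := [set z | 0 < nu z]%SET.
have nuA : \sum_(z in A) nu z <= 2 * eps.
  rewrite sumrB; have := tv x A; have := tv y (~: A)%SET.
  have cmpl (F : S -> R) : \sum_z F z = 1 ->
      \sum_(z in (~: A)%SET) F z = 1 - \sum_(z in A) F z.
    move=> F1; rewrite -F1 [in RHS](bigID (mem A)) /= addrAC subrr add0r.
    by apply: eq_bigl => z; rewrite inE.
  by rewrite !cmpl ?trans_prob_sum //; lra.
pose z0 := [arg min_(z < x) f z]%O.
have z0P z : f z0 <= f z by rewrite /z0; case: arg_minP => // i _; apply.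
have -> : flow f t x - flow f t y = \sum_z nu z * (f z - f z0).
  under eq_bigr do rewrite mulrBr.
  rewrite sumrB -mulr_suml /nu sumrB !trans_prob_sum // subrr mul0r subr0.
  by rewrite /flow -sumrB; apply: eq_bigr => z _; rewrite mulrBl.
apply: (@le_trans _ _ ((\sum_(z in A) nu z) * d)); last by rewrite ler_wpM2r.
rewrite mulr_suml [leRHS]big_mkcond /=; apply: ler_sum => z _.
rewrite inE; case: ltP => nuz.
  by rewrite ler_wpM2l // ltW.
by rewrite mulr_le0_ge0 // subr_ge0.
Qed.

(** At level 1/4 the factor [2 * eps] is 1/2: each period [t] halves the oscillation. *)
Lemma worst_dTV_iter (t : R) f (d : R) : (0 < #|S|)%N -> 0 <= t ->
  worst_dTV rate t <= 1 / 4 ->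
  (forall x y, f x - f y <= d) ->
  forall j x y, flow f (j%:R * t) x - flow f (j%:R * t) y <= d / 2 ^+ j.
Proof.
move=> S0 t0 mixt fd; elim=> [|j IH] x y.
  by rewrite mul0r !flow0 expr0 divr1.
rewrite -natr1 mulrDl mul1r !flowD //.
apply: le_trans (worst_dTV_flow S0 t0 mixt IH x y) _.
by rewrite exprS invfM; lra.
Qed.

(** By stationarity the stationary mass of an event is an average of its probabilities at time [t]
    over starting points, so it suffices to compare starting points. *)
Lemma worst_dTV_le (eps t : R) : (0 < #|S|)%N -> 0 <= t -> 0 <= eps ->
  (forall f, (forall x, 0 <= f x <= 1) -> forall x y, flow f t x - flow f t y <= eps) ->
  worst_dTV rate t <= eps.
Proof.
move=> S0 t0 eps0 Hf.
have [[pi0 pi1] pis] := stationaryP S0.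
apply: bigmax_le => // x _; apply: bigmax_le => // A _.
pose f z : R := (z \in A)%:R.
have flowA z : \sum_(v in A) trans_prob rate t z v = flow f t z.
  rewrite /flow big_mkcond /=; apply: eq_bigr => v _.
  by rewrite /f; case: (v \in A); rewrite ?mulr1 ?mulr0.
have -> : \sum_(v in A) stationary rate v = \sum_y stationary rate y * flow f t y.
  under [RHS]eq_bigr do rewrite -flowA mulr_sumr.
  by rewrite exchange_big /=; apply: eq_bigr => v _; rewrite pis.
rewrite flowA -[flow f t x]mul1r -pi1 mulr_suml -sumrB -[leRHS]mul1r -pi1 mulr_suml.
apply: ler_sum => y _; rewrite -mulrBr ler_wpM2l //; apply: Hf => z.
by rewrite /f; case: (z \in A); rewrite ler01 lexx.
Qed.

End JumpChain.

(** * Two particles on a weighted graph *)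

Section EdgeSwap.
Context {V : finType}.
Implicit Types (e : {set V}) (x y : V).

Lemma edge_swapK e : involutive (edge_swap e).
Proof.
move=> x; rewrite /edge_swap; case: (enum e) => [|a [|b []]] *; rewrite ?perm1 //.
by rewrite tpermK.
Qed.

Lemma edge_swap_out e x : x \notin e -> edge_swap e x = x.
Proof.
rewrite -mem_enum /edge_swap; case: (enum e) => [|a [|b []]]; rewrite ?perm1 //.
rewrite !inE negb_or.
by rewrite eq_sym [x == b]eq_sym => /andP[*]; rewrite tpermD.
Qed.

Lemma pair2_move_inj (s : {perm V}) : injective (pair2_move s).
Proof.
move=> [[a b] ab] [[c d] cd] /(congr1 val) [/perm_inj ac /perm_inj bd].
by apply: val_inj; rewrite /= ac bd.
Qed.

End EdgeSwap.

Section TwoParticles.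
Context {R : realType} {G : wgraph R}.
Local Notation V := (vertex G).
Local Notation wt := (@weight R G).
Local Notation sw := edge_swap.
Implicit Types (x y z : V) (e : {set V}) (s t : R) (F : V -> V -> R).

Definition walk_gen (f : V -> R) x := \sum_(e in edge G) wt e * (f (sw e x) - f x).

Definition indep_gen F x y := walk_gen (F^~ y) x + walk_gen (F x) y.

Definition exch_gen F x y :=
  \sum_(e in edge G) wt e * (F (sw e x) (sw e y) - F x y).

(** Edges are split according to whether they join the two particles. [far_gen] is the part of the
    dynamics shared by exchanging and independent particles. *)
Definition far_weight e x y := if e == [set x; y]%SET then 0 else wt e.

Definition contact_weight x y :=
  \sum_(e in edge G) (if e == [set x; y]%SET then wt e else 0).

Definition far_gen F x y :=
  \sum_(e in edge G) far_weight e x y * (F (sw e x) (sw e y) - F x y).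

Lemma far_weight_ge0 e x y : e \in edge G -> 0 <= far_weight e x y.
Proof. by move=> Ee; rewrite /far_weight; case: ifP => // _; rewrite ltW // weight_gt0. Qed.

Lemma contact_weight_ge0 x y : 0 <= contact_weight x y.
Proof. by apply: sumr_ge0 => e Ee; case: ifP => // _; rewrite ltW // weight_gt0. Qed.

Lemma exch_genE F x y : x != y ->
  exch_gen F x y = far_gen F x y + contact_weight x y * (F y x - F x y).
Proof.
move=> xy; rewrite /exch_gen /far_gen /contact_weight mulr_suml -big_split /=.
apply: eq_bigr => e Ee; rewrite /far_weight; case: eqP => [->|_].
  by rewrite edge_swapE // tpermL tpermR mul0r add0r.
by rewrite mul0r addr0.
Qed.

(** An edge other than [xy] contains at most one of the two particles, so swapping both coordinates
    moves just that one. Across [xy], either walk may jump onto the other. *)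
Lemma indep_genE F x y : x != y -> indep_gen F x y =
  far_gen F x y + contact_weight x y * (F x x + F y y - 2 * F x y).
Proof.
move=> xy; rewrite /indep_gen /walk_gen /far_gen /contact_weight mulr_suml -!big_split /=.
apply: eq_bigr => e Ee; rewrite /far_weight; case: eqP => [->|exy].
  by rewrite edge_swapE // tpermL tpermR; ring.
have [xe|/edge_swap_out ->] := boolP (x \in e); last by ring.
have [ye|/edge_swap_out ->] := boolP (y \in e); last by ring.
case: exy; apply/esym/eqP; rewrite eqEcard cards2 xy (card_edge Ee) andbT.
by apply/fintype.subsetP => z; rewrite !inE => /orP[] /eqP ->.
Qed.

Lemma walk_gen_adjoint (f k : V -> R) :
  \sum_x walk_gen f x * k x = \sum_x f x * walk_gen k x.
Proof.
rewrite /walk_gen; under eq_bigr do rewrite mulr_suml.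
under [RHS]eq_bigr do rewrite mulr_sumr.
rewrite exchange_big [RHS]exchange_big /=; apply: eq_bigr => e _.
under eq_bigr do rewrite -mulrA mulrBl.
under [RHS]eq_bigr do rewrite mulrCA mulrBr.
rewrite -!mulr_sumr !sumrB; congr (_ * (_ - _)).
rewrite (reindex_inj (@perm_inj _ (sw e))) /=.
by apply: eq_bigr => x _; rewrite edge_swapK.
Qed.

Lemma exch_equation_ge0 (u r : R -> V -> V -> R) :
  (forall x y, x != y -> 0 <= u 0 x y) ->
  (forall s x y, 0 <= s -> x != y -> 0 <= r s x y) ->
  (forall s x y, x != y -> is_derive s 1 (fun s => u s x y)
     (exch_gen (u s) x y + r s x y)) ->
  forall t x y, 0 <= t -> x != y -> 0 <= u t x y.
Proof.
move=> u0 r0 du t x y t0 xy.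
have du' s (p : V * V) : p.1 != p.2 -> is_derive s 1 (fun s => u s p.1 p.2)
    (\sum_(e in edge G) wt e * u s (sw e p.1) (sw e p.2)
     - (\sum_(e in edge G) wt e) * u s p.1 p.2 + r s p.1 p.2).
  move=> xy'; apply: (is_derive_eq (du _ _ _ xy')); congr (_ + _).
  by rewrite mulr_suml -sumrB; apply: eq_bigr => e _; rewrite mulrBr.
apply: (@jump_equation_ge0 _ _ _ (mem (edge G)) (fun e _ => wt e)
  (fun e p => (sw e p.1, sw e p.2)) _ (fun p => p.1 != p.2) _ _
  (fun s p => u s p.1 p.2) (fun s p => r s p.1 p.2) _ _ du' t (x, y)) => //=.
- by move=> e p Ee _; rewrite ltW // weight_gt0.
- by move=> e p _; rewrite (inj_eq perm_inj).
- by move=> p; exact: u0.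
- by move=> s' p; exact: r0.
Qed.

(** Killing has twice the contact weight because each of two independent walks can jump onto the
    other. *)
Lemma killed_equation_ge0 (u r : R -> V -> V -> R) :
  (forall x y, x != y -> 0 <= u 0 x y) ->
  (forall s x y, 0 <= s -> x != y -> 0 <= r s x y) ->
  (forall s x y, x != y -> is_derive s 1 (fun s => u s x y)
     (far_gen (u s) x y - 2 * contact_weight x y * u s x y + r s x y)) ->
  forall t x y, 0 <= t -> x != y -> 0 <= u t x y.
Proof.
move=> u0 r0 du t x y t0 xy.
have du' s (p : V * V) : p.1 != p.2 -> is_derive s 1 (fun s => u s p.1 p.2)
    (\sum_(e in edge G) far_weight e p.1 p.2 * u s (sw e p.1) (sw e p.2)
     - (\sum_(e in edge G) far_weight e p.1 p.2 + 2 * contact_weight p.1 p.2)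
       * u s p.1 p.2 + r s p.1 p.2).
  move=> xy'; apply: (is_derive_eq (du _ _ _ xy')); congr (_ + _).
  rewrite [in RHS]mulrDl opprD addrA; congr (_ - _).
  by rewrite mulr_suml -sumrB; apply: eq_bigr => e _; rewrite mulrBr.
apply: (@jump_equation_ge0 _ _ _ (mem (edge G)) (fun e p => far_weight e p.1 p.2)
  (fun e p => (sw e p.1, sw e p.2)) _ (fun p => p.1 != p.2) _ _
  (fun s p => u s p.1 p.2) (fun s p => r s p.1 p.2) _ _ du' t (x, y)) => //=.
- by move=> e p Ee _; rewrite far_weight_ge0.
- by move=> e p _; rewrite (inj_eq perm_inj).
- by move=> p; exact: u0.
- by move=> s' p; exact: r0.
Qed.

Definition walk_flow (f : V -> R) t x := flow (edge G) wt (fun e => sw e) f t x.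

Lemma is_derive_walk_flow f t x :
  is_derive t 1 (fun s => walk_flow f s x) (walk_gen (walk_flow f t) x).
Proof. exact: is_derive_flow. Qed.

Lemma wt_ge0 e : e \in edge G -> 0 <= wt e.
Proof. by move=> Ee; rewrite ltW // weight_gt0. Qed.

Definition indep_flow F t x y := walk_flow (fun x' => walk_flow (F x') t y) t x.

Lemma indep_flow0 F x y : indep_flow F 0 x y = F x y.
Proof. by rewrite /indep_flow /walk_flow !flow0. Qed.

Lemma is_derive_indep_flow F t x y :
  is_derive t 1 (fun s => indep_flow F s x y) (indep_gen (indep_flow F t) x y).
Proof.
have D x' := is_derive_mul (is_derive_trans_prob (edge G) wt (fun e => sw e) t x x')
                           (is_derive_walk_flow (F x') t y).
apply: (is_derive_eq (is_derive_bigsum _ (fun x' _ => D x'))).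
rewrite big_split /= /indep_gen; congr (_ + _).
  under eq_bigr do rewrite mulr_suml.
  rewrite exchange_big /=; apply: eq_bigr => e _.
  rewrite /indep_flow {2 3}/walk_flow /flow -sumrB mulr_sumr.
  by apply: eq_bigr => x' _; rewrite /walk_flow /flow; ring.
under eq_bigr do rewrite mulr_sumr.
rewrite exchange_big /=; apply: eq_bigr => e _.
rewrite /indep_flow {3 5}/walk_flow /flow -sumrB mulr_sumr.
by apply: eq_bigr => x' _; rewrite /walk_flow /flow; ring.
Qed.

Lemma indep_flow_le F F' t x y : 0 <= t -> (forall x y, F x y <= F' x y) ->
  indep_flow F t x y <= indep_flow F' t x y.
Proof.
move=> t0 FF'; apply: flow_le => // [|x']; first exact: wt_ge0.
by apply: flow_le => //; exact: wt_ge0.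
Qed.

Lemma indep_flow_cst (a t : R) x y : 0 <= t -> indep_flow (fun _ _ => a) t x y = a.
Proof.
move=> t0; rewrite /indep_flow /walk_flow.
rewrite (_ : (fun x' => _) = fun=> a); last first.
  by apply/funext => x'; rewrite flow_cst //; exact: wt_ge0.
by rewrite flow_cst //; exact: wt_ge0.
Qed.

Lemma indep_flow_bound F (a b t : R) x y : 0 <= t ->
  (forall x y, a <= F x y <= b) -> a <= indep_flow F t x y <= b.
Proof.
move=> t0 Fab; rewrite -{1}(indep_flow_cst a x y t0) -{1}(indep_flow_cst b x y t0).
by rewrite !indep_flow_le // => x' y'; have /andP[] := Fab x' y'.
Qed.

Lemma walk_flow_compl (f : V -> R) t x : 0 <= t ->
  walk_flow (fun y => 1 - f y) t x = 1 - walk_flow f t x.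
Proof.
move=> t0; rewrite -[in RHS](flow_cst (fun e => sw e) wt_ge0 1 x t0).
by rewrite /walk_flow -flowB.
Qed.

Lemma indep_flow_compl F t x y : 0 <= t ->
  indep_flow (fun x y => 1 - F x y) t x y = 1 - indep_flow F t x y.
Proof.
move=> t0; rewrite /indep_flow -walk_flow_compl //; congr (walk_flow _ _ _).
by apply/funext => x'; rewrite walk_flow_compl.
Qed.

(** One starting point is changed at a time, each change costing [1 / 2 ^+ j]. *)
Lemma indep_flow_mix F T j : (0 < #|V|)%N -> 0 <= T ->
  worst_dTV (@RW R G) T <= 1 / 4 -> (forall x y, 0 <= F x y <= 1) ->
  forall x y x' y',
  indep_flow F (j%:R * T) x y - indep_flow F (j%:R * T) x' y' <= 2 / 2 ^+ j.
Proof.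
move=> V0 T0 mixT F01 x y x' y'.
have jT : 0 <= j%:R * T by rewrite mulr_ge0.
have w0 := wt_ge0.
have osc (f : V -> R) : (forall x y, f x - f y <= 1) -> forall x y,
    walk_flow f (j%:R * T) x - walk_flow f (j%:R * T) y <= 1 / 2 ^+ j.
  move=> fd; apply: worst_dTV_iter => // e; exact: perm_inj.
pose mid := indep_flow F (j%:R * T) x' y.
have H1 : indep_flow F (j%:R * T) x y - mid <= 1 / 2 ^+ j.
  apply: osc => z z'; rewrite -flowB.
  rewrite -[leRHS](flow_cst (fun e => sw e) w0 1 y jT).
  apply: flow_le => // v.
  by have /andP[_ ?] := F01 z v; have /andP[? _] := F01 z' v; lra.
have H2 : mid - indep_flow F (j%:R * T) x' y' <= 1 / 2 ^+ j.
  rewrite /mid /indep_flow -flowB -[leRHS](flow_cst (fun e => sw e) w0 (1 / 2 ^+ j) x' jT).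
  apply: flow_le => // v; apply: osc => z z'.
  by have /andP[_ ?] := F01 v z; have /andP[? _] := F01 v z'; lra.
lra.
Qed.

End TwoParticles.

(** * The meeting probability of independent walks *)

Section NonMeeting.
Context {R : realType} {G : wgraph R}.
Local Notation V := (vertex G).
Local Notation wt := (@weight R G).
Local Notation sw := edge_swap.
Local Notation cw := (@contact_weight R G).
Implicit Types (x y z : V) (e : {set V}) (s t : R) (F : V -> V -> R).

Lemma far_genD F F' x y :
  far_gen (fun x y => F x y + F' x y) x y = far_gen F x y + far_gen F' x y.
Proof. by rewrite /far_gen -big_split /=; apply: eq_bigr => e _; ring. Qed.

Lemma far_genB F F' x y :
  far_gen (fun x y => F x y - F' x y) x y = far_gen F x y - far_gen F' x y.
Proof. by rewrite /far_gen -sumrB; apply: eq_bigr => e _; ring. Qed.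

Lemma far_genZ (a : R) F x y : far_gen (fun x y => a * F x y) x y = a * far_gen F x y.
Proof. by rewrite /far_gen mulr_sumr; apply: eq_bigr => e _; ring. Qed.

Lemma far_genC (a : R) x y : far_gen (fun _ _ => a) x y = 0.
Proof. by rewrite /far_gen big1 // => e _; rewrite subrr mulr0. Qed.

(* [h t x y] is the probability that independent walks from [x] and [y] have not
   met by time [t]: [indep_gen] killed on the diagonal. *)
Definition nonmeeting (h : R -> V -> V -> R) :=
  [/\ forall x y, h 0 x y = (x != y)%:R,
      forall s x, h s x x = 0 &
      forall s x y, x != y -> is_derive s 1 (fun s => h s x y)
        (far_gen (h s) x y - 2 * cw x y * h s x y)].

Lemma nonmeeting_exists : exists h, nonmeeting h.
Proof.
pose c (p : V * V) : R := if p.1 == p.2 then 0 else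
  \sum_(e in edge G) far_weight e p.1 p.2 + 2 * cw p.1 p.2.
(* All rates vanish on the diagonal, where the initial value is 0, so the solution stays 0 there. *)
have [u [u0 du]] := jump_equation_exists (mem (edge G))
  (fun e (p : V * V) => if p.1 == p.2 then 0 else far_weight e p.1 p.2)
  (fun e p => (sw e p.1, sw e p.2)) c (fun p => (p.1 != p.2)%:R).
exists (fun s x y => u s (x, y)); split=> [x y|s x|s x y xy].
- by rewrite u0.
- have du0 (r : R) : is_derive r 1 (fun s => u s (x, x)) 0.
    apply: (is_derive_eq (du r (x, x))).
    by rewrite /c /= eqxx mul0r subr0 big1 // => e _; rewrite mul0r.
  by rewrite (is_derive_0_is_cst s 0 du0) u0 /= eqxx.
- apply: (is_derive_eq (du s (x, y))); rewrite /c /= (negbTE xy) mulrDl opprD addrA.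
  congr (_ - _); rewrite mulr_suml -sumrB; apply: eq_bigr => e _.
  by rewrite mulrBr.
Qed.

Definition exch_solution (phi : R -> V -> V -> R) := forall s x y, x != y ->
  is_derive s 1 (fun s => phi s x y) (exch_gen (phi s) x y).

Lemma exch_solution_shift (a : R) phi :
  exch_solution phi -> exch_solution (fun s => phi (a + s)).
Proof.
by move=> dphi s x y xy; apply: (is_derive_shiftl (f := fun s => phi s x y)); exact: dphi.
Qed.

Lemma exch_solution_compl phi :
  exch_solution phi -> exch_solution (fun s x y => 1 - phi s x y).
Proof.
move=> dphi s x y xy.
apply: (is_derive_eq (is_derive_csub 1 (dphi s x y xy))).
by rewrite /exch_gen -sumrN; apply: eq_bigr => e _; ring.
Qed.

Lemma exch_solution_swap phi :
  exch_solution phi -> exch_solution (fun s x y => phi s y x).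
Proof. by move=> dphi s x y xy; apply: dphi; rewrite eq_sym. Qed.

Lemma exch_solution_ge0 phi : exch_solution phi ->
  (forall x y, x != y -> 0 <= phi 0 x y) ->
  forall t x y, 0 <= t -> x != y -> 0 <= phi t x y.
Proof.
move=> dphi phi0; apply: (exch_equation_ge0 (r := fun _ _ _ => 0)) => // s x y xy.
by rewrite addr0; exact: dphi.
Qed.

Lemma exch_solution_le1 phi : exch_solution phi ->
  (forall x y, x != y -> phi 0 x y <= 1) ->
  forall t x y, 0 <= t -> x != y -> phi t x y <= 1.
Proof.
move=> dphi phi1 t x y t0 xy; rewrite -subr_ge0.
apply: (exch_solution_ge0 (exch_solution_compl dphi)) => // x' y' xy'.
by rewrite subr_ge0 phi1.
Qed.

Variable h : R -> V -> V -> R.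
Hypothesis hP : nonmeeting h.

Let m t x y : R := 1 - h t x y.

Lemma nonmeeting_ge0 t x y : 0 <= t -> 0 <= h t x y.
Proof.
case: hP => h0 hd dh t0; have [->|xy] := eqVneq x y; first by rewrite hd.
apply: (killed_equation_ge0 (r := fun _ _ _ => 0)) => // [x' y' _|s x' y' xy'].
  by rewrite h0.
by rewrite addr0; exact: dh.
Qed.

Lemma nonmeeting_le1 t x y : 0 <= t -> h t x y <= 1.
Proof.
case: hP => h0 hd dh t0; have [->|xy] := eqVneq x y; first by rewrite hd.
rewrite -subr_ge0; apply: (killed_equation_ge0
  (u := fun t x y => 1 - h t x y) (r := fun _ x y => 2 * cw x y)) => //
  [x' y' xy'|s x' y' _ _|s x' y' xy'].
- by rewrite h0 xy' subrr.
- by rewrite mulr_ge0 ?contact_weight_ge0.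
- apply: (is_derive_eq (is_derive_csub 1 (dh s _ _ xy'))).
  by rewrite far_genB far_genC; ring.
Qed.

(* [m] solves the equation of two independent walks, with a nonnegative source
   supported on the diagonal; hence it is a superposition of kernels of the form
   \sum_z rho z * p_s x z * p_s y z *)
Lemma meeting_posdef (alpha : V -> R) t : 0 <= t ->
  0 <= \sum_x \sum_y alpha x * alpha y * m t x y.
Proof.
case: (hP) => h0 hd dh t0.
pose a (r : R) := walk_flow alpha r.
(* Since [m] is constantly 1 on the diagonal, this is the source that makes the independent equation
   hold there too. *)
pose src s x := - indep_gen (m s) x x.
have src0 s x : 0 <= s -> 0 <= src s x.
  move=> s0; rewrite /src /indep_gen /walk_gen -big_split -sumrN /=.
  apply: sumr_ge0 => e Ee; rewrite /m !hd subr0.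
  have := nonmeeting_ge0 (sw e x) x s0; have := nonmeeting_ge0 x (sw e x) s0.
  move=> H1 H2; rewrite -mulrDr -mulrN mulr_ge0 ?wt_ge0 //; lra.
have dm s x y : is_derive s 1 (fun s => m s x y)
    (indep_gen (m s) x y + (x == y)%:R * src s x).
  have [<-|xy] := eqVneq x y.
    rewrite mul1r /src subrr (_ : (fun s => m s x x) = cst 1); first exact: is_derive_cst.
    by apply/funext => r; rewrite /m hd subr0.
  apply: (is_derive_eq (is_derive_csub 1 (dh s _ _ xy))).
  by rewrite indep_genE // /m far_genB far_genC !hd mul0r; ring.
(* [Q] runs [alpha] for the remaining time: [Q t] is the form in question and [Q 0] is a sum of
   squares. By symmetry of the walk the generator terms cancel in [dQ], leaving the source times
   squares. *)
pose Q s := \sum_x \sum_y a (t - s) x * a (t - s) y * m s x y.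
pose dQ s := \sum_x \sum_y
  ((- walk_gen (a (t - s)) x * a (t - s) y + a (t - s) x * - walk_gen (a (t - s)) y) * m s x y
   + a (t - s) x * a (t - s) y * (indep_gen (m s) x y + (x == y)%:R * src s x)).
have dQP s : is_derive s 1 Q (dQ s).
  apply: is_derive_bigsum => x _; apply: is_derive_bigsum => y _.
  have da z := is_derive_reflect (is_derive_walk_flow alpha (t - s) z).
  exact: (is_derive_mul (is_derive_mul (da x) (da y)) (dm s x y)).
have dQE s : dQ s = \sum_x a (t - s) x ^+ 2 * src s x.
  set b := a (t - s).
  have E1 : \sum_x \sum_y walk_gen b x * b y * m s x y =
            \sum_x \sum_y b x * b y * walk_gen (m s ^~ y) x.
    rewrite exchange_big [RHS]exchange_big /=; apply: eq_bigr => y _.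
    transitivity (b y * \sum_x walk_gen b x * m s x y).
      by rewrite mulr_sumr; apply: eq_bigr => x _; ring.
    by rewrite walk_gen_adjoint mulr_sumr; apply: eq_bigr => x _; ring.
  have E2 : \sum_x \sum_y b x * walk_gen b y * m s x y =
            \sum_x \sum_y b x * b y * walk_gen (m s x) y.
    apply: eq_bigr => x _; transitivity (b x * \sum_y walk_gen b y * m s x y).
      by rewrite mulr_sumr; apply: eq_bigr => y _; ring.
    by rewrite walk_gen_adjoint mulr_sumr; apply: eq_bigr => y _; ring.
  have E3 : \sum_x b x ^+ 2 * src s x = \sum_x \sum_y b x * b y * ((x == y)%:R * src s x).
    apply: eq_bigr => x _; rewrite (bigD1 x) //= eqxx mul1r big1 ?addr0 ?expr2 // => y yx.
    by rewrite eq_sym (negbTE yx) mul0r mulr0.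
  transitivity (\sum_x \sum_y b x * b y * walk_gen (m s ^~ y) x
      - \sum_x \sum_y walk_gen b x * b y * m s x y
      + (\sum_x \sum_y b x * b y * walk_gen (m s x) y
         - \sum_x \sum_y b x * walk_gen b y * m s x y)
      + \sum_x b x ^+ 2 * src s x); last by rewrite E1 E2 !subrr !add0r.
  rewrite E3 -!sumrB -!big_split /=; apply: eq_bigr => x _.
  rewrite -!sumrB -!big_split /=; apply: eq_bigr => y _.
  by rewrite /indep_gen -/b; ring.
have : Q 0 <= Q t.
  apply: is_derive_ge0_le t0 dQP _ => s /andP[s0 _]; rewrite dQE.
  by apply: sumr_ge0 => x _; rewrite mulr_ge0 ?sqr_ge0 ?src0.
have -> : Q t = \sum_x \sum_y alpha x * alpha y * m t x y.
  apply: eq_bigr => x _; apply: eq_bigr => y _.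
  by rewrite /a subrr /walk_flow !flow0.
apply: le_trans; apply: sumr_ge0 => x _.
rewrite (bigD1 x) //= big1 => [|y yx]; rewrite /m h0; last by rewrite eq_sym yx subrr mulr0.
by rewrite eqxx /= !subr0 mulr1 addr0 -expr2 sqr_ge0.
Qed.

(** This is the quadratic form of [m t] at the difference of the laws at time [s] of walks started
    from [x] and [y]. *)
Lemma indep_flow_meeting_posdef s t x y : 0 <= t ->
  let psi := indep_flow (m t) s in
  0 <= psi x x + psi y y - psi x y - psi y x.
Proof.
move=> t0 /=; pose p z z' := trans_prob (@RW R G) s z z'.
have E z z' : indep_flow (m t) s z z' = \sum_u \sum_v p z u * p z' v * m t u v.
  by apply: eq_bigr => u _; rewrite mulr_sumr; apply: eq_bigr => v _; rewrite mulrA.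
have := meeting_posdef (fun u => p x u - p y u) t0.
congr (_ <= _); rewrite !E -big_split -!sumrB /=; apply: eq_bigr => u _.
by rewrite -big_split -!sumrB /=; apply: eq_bigr => v _; ring.
Qed.

End NonMeeting.

(** * Comparison of exchanging and independent particles *)

Section Comparisons.
Context {R : realType} {G : wgraph R}.
Local Notation V := (vertex G).
Local Notation wt := (@weight R G).
Local Notation sw := edge_swap.
Local Notation cw := (@contact_weight R G).
Implicit Types (x y z : V) (e : {set V}) (s t : R) (F : V -> V -> R).
Variable h : R -> V -> V -> R.
Hypothesis hP : nonmeeting h.

Let m t x y : R := 1 - h t x y.

Let m01 t x y : 0 <= t -> 0 <= m t x y <= 1.
Proof.
by move=> t0; rewrite /m subr_ge0 (nonmeeting_le1 hP) //= gerBl (nonmeeting_ge0 hP).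
Qed.

(** The two processes agree until contact; the source collects what happens at contact, and is
    nonnegative because [phi] is at most 1 and the independent flow is nonnegative. *)
Lemma exch_solution_le_indep phi F : exch_solution phi ->
  (forall x y, 0 <= F x y <= 1) -> (forall x y, x != y -> phi 0 x y = F x y) ->
  forall t x y, 0 <= t -> x != y -> phi t x y <= indep_flow F t x y + m t x y.
Proof.
case: (hP) => h0 hd dh dphi F01 phiF t x y t0 xy; rewrite -subr_ge0.
pose psi s := indep_flow F s.
apply: (killed_equation_ge0
  (u := fun t x y => psi t x y + (1 - h t x y) - phi t x y)
  (r := fun s x y => cw x y *
     (psi s x x + psi s y y + ((1 - phi s x y) + (1 - phi s y x))))) => //
  [x' y' xy'|s x' y' s0 xy'|s x' y' xy'].
- by rewrite /psi indep_flow0 h0 xy' phiF // subrr addr0 subrr.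
- have phi1 z z' : z != z' -> phi s z z' <= 1.
    by apply: exch_solution_le1 => // a b ab; rewrite phiF //; have /andP[] := F01 a b.
  have psi0 z : 0 <= psi s z z by have /andP[] := indep_flow_bound z z s0 F01.
  apply: mulr_ge0; first exact: contact_weight_ge0.
  have yx' : y' != x' by rewrite eq_sym.
  by rewrite addr_ge0 // addr_ge0 ?psi0 ?subr_ge0 ?phi1.
- have D1 := is_derive_indep_flow F s x' y'.
  have D2 := is_derive_csub 1 (dh s _ _ xy').
  apply: (is_derive_eq (is_derive_sub (is_derive_add D1 D2) (dphi s _ _ xy'))).
  rewrite far_genB far_genD far_genB far_genC indep_genE // exch_genE // /psi.
  by ring.
Qed.

(* Positive definiteness of the meeting probability makes [indep_gen] dominate
   [exch_gen] along [indep_flow (m t)]. *)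
Lemma exch_solution_le_meeting phi (C t : R) : exch_solution phi -> 0 <= t ->
  (forall x y, x != y -> phi 0 x y <= C + m t x y) ->
  forall s x y, 0 <= s -> x != y -> phi s x y <= C + indep_flow (m t) s x y.
Proof.
move=> dphi t0 phi0 s x y s0 xy; rewrite -subr_ge0.
pose psi s := indep_flow (m t) s.
apply: (exch_equation_ge0 (u := fun s x y => C + psi s x y - phi s x y)
  (r := fun s x y => cw x y * (psi s x x + psi s y y - psi s x y - psi s y x))) => //
  [x' y' xy'|r x' y' r0 xy'|r x' y' xy'].
- by rewrite /psi indep_flow0 subr_ge0 phi0.
- by apply: mulr_ge0; [exact: contact_weight_ge0|exact: indep_flow_meeting_posdef].
- have D1 := is_derive_add (is_derive_cst C r 1) (is_derive_indep_flow (m t) r x' y').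
  apply: (is_derive_eq (is_derive_sub D1 (dphi r _ _ xy'))).
  rewrite indep_genE // !exch_genE // far_genB far_genD far_genC /psi.
  by ring.
Qed.

(** Meeting during the last [t] units of time implies meeting within [t + s]. *)
Lemma indep_flow_meeting_le s t x y : 0 <= s -> 0 <= t -> x != y ->
  indep_flow (m t) s x y <= m (t + s) x y.
Proof.
case: (hP) => h0 hd dh s0 t0 xy; rewrite -subr_ge0.
pose psi s := indep_flow (m t) s.
apply: (killed_equation_ge0 (u := fun s x y => 1 - h (t + s) x y - psi s x y)
  (r := fun s x y => cw x y * ((1 - psi s x x) + (1 - psi s y y)))) => //
  [x' y' xy'|r x' y' r0 xy'|r x' y' xy'].
- by rewrite /psi indep_flow0 addr0 /m subrr.
- have psi1 z : psi r z z <= 1.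
    by have /andP[] := indep_flow_bound z z r0 (fun x y => m01 x y t0).
  by rewrite mulr_ge0 ?contact_weight_ge0 // addr_ge0 ?subr_ge0.
- have D1 : is_derive r 1 (fun s => h (t + s) x' y')
      (far_gen (h (t + r)) x' y' - 2 * cw x' y' * h (t + r) x' y').
    by apply: (is_derive_shiftl (f := fun s => h s x' y')); exact: dh.
  apply: (is_derive_eq (is_derive_sub (is_derive_csub 1 D1)
    (is_derive_indep_flow (m t) r x' y'))).
  by rewrite indep_genE // !far_genB far_genC /psi; ring.
Qed.

(** The Markov property at time [s], in the form of a comparison of two killed solutions. *)
Lemma nonmeeting_mul (a t : R) : 0 <= t -> (forall x y, x != y -> h t x y <= a) ->
  forall s x y, 0 <= s -> x != y -> h (t + s) x y <= a * h s x y.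
Proof.
case: (hP) => h0 hd dh t0 ha s x y s0 xy; rewrite -subr_ge0.
apply: (killed_equation_ge0 (u := fun s x y => a * h s x y - h (t + s) x y)
  (r := fun _ _ _ => 0)) => // [x' y' xy'|r x' y' xy'].
- by rewrite h0 xy' mulr1 addr0 subr_ge0 ha.
- have D1 : is_derive r 1 (fun s => h (t + s) x' y')
      (far_gen (h (t + r)) x' y' - 2 * cw x' y' * h (t + r) x' y').
    by apply: (is_derive_shiftl (f := fun s => h s x' y')); exact: dh.
  apply: (is_derive_eq (is_derive_sub (is_derive_mulc a (dh r _ _ xy')) D1)).
  by rewrite far_genB far_genZ; ring.
Qed.

Lemma nonmeeting_iter (a t : R) : 0 <= t -> 0 <= a ->
  (forall x y, x != y -> h t x y <= a) ->
  forall k x y, x != y -> h (k%:R * t) x y <= a ^+ k.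
Proof.
case: (hP) => h0 hd dh t0 a0 ha; elim=> [|k IH] x y xy.
  by rewrite mul0r h0 xy expr0.
rewrite -natr1 mulrDl mul1r addrC exprS.
apply: le_trans (nonmeeting_mul t0 ha _ xy) _; first by rewrite mulr_ge0.
by rewrite ler_wpM2l // IH.
Qed.

(* A function of three exchanging particles that is antisymmetric in the first
   two decays as if it were killed when these two are exchanged. *)
Lemma exch_solution_move phi : exch_solution phi ->
  (forall x y, x != y -> 0 <= phi 0 x y <= 1) ->
  forall t x y z, 0 <= t -> x != y -> x != z -> y != z ->
  phi t x z - phi t y z <= h t x y.
Proof.
case: (hP) => h0 hd dh dphi phi01 t x y z t0 xy xz yz; rewrite -subr_ge0.
pose D (p : V * V * V) := [&& p.1.1 != p.1.2, p.1.1 != p.2 & p.1.2 != p.2].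
pose fw e (p : V * V * V) := far_weight e p.1.1 p.1.2.
pose u s (p : V * V * V) := h s p.1.1 p.1.2 - (phi s p.1.1 p.2 - phi s p.1.2 p.2).
pose gg e (p : V * V * V) := (sw e p.1.1, sw e p.1.2, sw e p.2).
have du s p : D p -> is_derive s 1 (fun s => u s p)
    (\sum_(e in edge G) fw e p * u s (gg e p)
     - (\sum_(e in edge G) fw e p + 2 * cw p.1.1 p.1.2) * u s p + 0).
  case: p => -[a b] c /and3P[/= ab ac bc].
  have D1 := is_derive_sub (dphi s _ _ ac) (dphi s _ _ bc).
  apply: (is_derive_eq (is_derive_sub (dh s _ _ ab) D1)).
  (* The edge [ab] reverses the sign of the difference, which therefore decreases at twice the
     contact weight: exactly the killing rate of [h]. *)
  have -> : exch_gen (phi s) a c - exch_gen (phi s) b c =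
      \sum_(e in edge G) far_weight e a b *
        ((phi s (sw e a) (sw e c) - phi s (sw e b) (sw e c)) - (phi s a c - phi s b c))
      - cw a b * (2 * (phi s a c - phi s b c)).
    rewrite /exch_gen /contact_weight mulr_suml -!sumrB; apply: eq_bigr => e Ee.
    rewrite /far_weight; case: eqP => [->|_]; last by ring.
    by rewrite edge_swapE // tpermL tpermR tpermD //; ring.
  rewrite /= /fw /u /gg /= addr0 [in RHS]mulrDl [in RHS]mulr_suml.
  rewrite [in RHS]opprD [in RHS]addrA -[in RHS]sumrB.
  rewrite [in RHS](_ : \sum_(e in edge G) _ = far_gen (h s) a b -
    \sum_(e in edge G) far_weight e a b *
     ((phi s (sw e a) (sw e c) - phi s (sw e b) (sw e c)) - (phi s a c - phi s b c))).
    by ring.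
  by rewrite /far_gen -sumrB; apply: eq_bigr => e _; ring.
apply: (@jump_equation_ge0 _ _ _ (mem (edge G)) fw gg _ D _ _ u (fun _ _ => 0)
   _ _ du t (x, y, z)) => //=.
- by move=> e p Ee _; exact: far_weight_ge0.
- by move=> e p _; rewrite /D /= !(inj_eq perm_inj).
- move=> [[a b] c] /and3P[/= ab ac bc]; rewrite /u /= h0 ab /=.
  have /andP[? ?] := phi01 _ _ ac; have /andP[? ?] := phi01 _ _ bc; lra.
- by rewrite /D /= xy xz yz.
Qed.

(** The same cancellation without a third particle: [phi t x y - phi t y x] changes sign across the
    edge [xy]. *)
Lemma exch_solution_exchange phi : exch_solution phi ->
  (forall x y, x != y -> 0 <= phi 0 x y <= 1) ->
  forall t x y, 0 <= t -> x != y -> phi t x y - phi t y x <= h t x y.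
Proof.
case: (hP) => h0 hd dh dphi phi01 t x y t0 xy; rewrite -subr_ge0.
apply: (killed_equation_ge0 (u := fun t x y => h t x y - (phi t x y - phi t y x))
  (r := fun _ _ _ => 0)) => // [x' y' xy'|s x' y' xy'].
- have yx' : y' != x' by rewrite eq_sym.
  rewrite h0 xy' /=; have /andP[? ?] := phi01 _ _ xy'.
  by have /andP[? ?] := phi01 _ _ yx'; lra.
- have yx' : y' != x' by rewrite eq_sym.
  have D1 := is_derive_sub (dphi s _ _ xy') (dphi s _ _ yx').
  apply: (is_derive_eq (is_derive_sub (dh s _ _ xy') D1)).
  have cwC : cw y' x' = cw x' y' by rewrite /contact_weight finset.setUC.
  have farC F : far_gen F y' x' = far_gen (fun x y => F y x) x' y'.
    by rewrite /far_gen /far_weight finset.setUC.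
  by rewrite !exch_genE // !far_genB cwC farC; ring.
Qed.

(** Two ordered pairs are linked by at most two changes of one coordinate through a pair of distinct
    vertices, unless each is the reverse of the other; then one exchange suffices. *)
Lemma exch_solution_meeting_mix phi (d t : R) : exch_solution phi ->
  (forall x y, x != y -> 0 <= phi 0 x y <= 1) -> 0 <= t ->
  (forall x y, x != y -> h t x y <= d) ->
  forall x y x' y', x != y -> x' != y' -> phi t x y - phi t x' y' <= 2 * d.
Proof.
move=> dphi phi01 t0 hd x y x' y' xy xy'.
have d0 : 0 <= d by apply: le_trans (hd _ _ xy); exact: nonmeeting_ge0.
have mv1 a b c : a != c -> b != c -> phi t a c - phi t b c <= d.
  move=> ac bc; have [->|ab] := eqVneq a b; first by rewrite subrr.
  by apply: le_trans (hd _ _ ab); exact: exch_solution_move.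
have mv2 a b c : c != a -> c != b -> phi t c a - phi t c b <= d.
  move=> ca cb; have [->|ab] := eqVneq a b; first by rewrite subrr.
  apply: le_trans (hd _ _ ab).
  apply: (exch_solution_move (exch_solution_swap dphi)) => //; last 2 first.
  - by rewrite eq_sym.
  - by rewrite eq_sym.
  - by move=> ? ? ?; apply: phi01; rewrite eq_sym.
have [yx'|x'y] := eqVneq x' y; last first.
  by have := mv1 x x' y xy x'y; have := mv2 y y' x' x'y xy'; lra.
have [xy2|xy2] := eqVneq x y'.
  subst x' y'; have := exch_solution_exchange dphi phi01 t0 xy.
  by have := hd _ _ xy; lra.
by have := mv2 y y' x xy xy2; have := mv1 x x' y' xy2 xy'; lra.
Qed.

Lemma exch_solution_separate_mix phi T : (0 < #|V|)%N -> 0 <= T ->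
  worst_dTV (@RW R G) T <= 1 / 4 -> exch_solution phi ->
  (forall x y, x != y -> 0 <= phi 0 x y <= 1) ->
  (forall x y, x != y -> indep_flow (m (5 * T)) (6 * T) x y <= 3 / 32) ->
  forall x y x' y', x != y -> x' != y' ->
  phi (11 * T) x y - phi (11 * T) x' y' <= 1 / 4.
Proof.
move=> V0 T0 mixT dphi phi01 small x y x' y' xy xy'.
(* Independent walks may meet, so the initial data need a value in [0, 1] on the diagonal; 0 is an
   arbitrary choice. *)
pose F x y := if x == y then 0 else phi 0 x y.
have F01 z z' : 0 <= F z z' <= 1.
  by rewrite /F; case: eqVneq => [_|/phi01 //]; rewrite lexx ler01.
have F01' z z' : 0 <= 1 - F z z' <= 1 by have := F01 z z'; lra.
have t5 : 0 <= 5 * T by rewrite mulr_ge0.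
have t6 : 0 <= 6 * T by rewrite mulr_ge0.
have -> : 11 * T = 5 * T + 6 * T by ring.
pose psi z z' := indep_flow F (5 * T) z z'.
pose hi := [arg max_(p > (x, y)) psi p.1 p.2]%O.
pose lo := [arg min_(p < (x, y)) psi p.1 p.2]%O.
have hiP z z' : psi z z' <= psi hi.1 hi.2.
  by rewrite /hi; case: arg_maxP => // i _ /(_ (z, z') isT).
have loP z z' : psi lo.1 lo.2 <= psi z z'.
  by rewrite /lo; case: arg_minP => // i _ /(_ (z, z') isT).
(* Five periods give [2 / 2 ^+ 5], that is 1/16; with the two errors 3/32 below, the total is
   1/4. *)
have hilo : psi hi.1 hi.2 - psi lo.1 lo.2 <= 1 / 16.
  apply: le_trans (indep_flow_mix 5 V0 T0 mixT F01 _ _ _ _) _.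
  by rewrite -natrX; lra.
(* Comparison with independent walks up to [5 * T] costs [m (5 * T)]; the expectation of this error
   after exchanging for [6 * T] is bounded by the independent one. *)
have up : phi (5 * T + 6 * T) x y <= psi hi.1 hi.2 + 3 / 32.
  apply: le_trans (_ : psi hi.1 hi.2 + indep_flow (m (5 * T)) (6 * T) x y <= _).
    apply: (exch_solution_le_meeting (exch_solution_shift (5 * T) dphi)) => // z z' zz'.
    rewrite addr0; apply: le_trans (exch_solution_le_indep dphi F01 _ t5 zz') _.
      by move=> ? ? /negbTE ab; rewrite /F ab.
    by rewrite lerD2r.
  by rewrite lerD2l small.
have down : 1 - phi (5 * T + 6 * T) x' y' <= (1 - psi lo.1 lo.2) + 3 / 32.
  apply: le_trans (_ : (1 - psi lo.1 lo.2) + indep_flow (m (5 * T)) (6 * T) x' y' <= _).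
    apply: (exch_solution_le_meeting
      (exch_solution_shift (5 * T) (exch_solution_compl dphi))) => // z z' zz'.
    rewrite addr0; apply: le_trans
      (exch_solution_le_indep (exch_solution_compl dphi) F01' _ t5 zz') _.
      by move=> ? ? /negbTE ab; rewrite /F ab.
    by rewrite indep_flow_compl // lerD2r lerB.
  by rewrite lerD2l small.
by move: up down hilo; move: (phi _ _ _) (phi _ _ _) (psi _ _) (psi _ _) => *; lra.
Qed.

Lemma exch_solution_mix T : (0 < #|V|)%N -> 0 <= T ->
  worst_dTV (@RW R G) T <= 1 / 4 ->
  exists2 k : nat, (k <= 20000)%N & forall phi, exch_solution phi ->
  (forall x y, x != y -> 0 <= phi 0 x y <= 1) ->
  forall x y x' y', x != y -> x' != y' ->
  phi (k%:R * T) x y - phi (k%:R * T) x' y' <= 1 / 4.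
Proof.
move=> V0 T0 mixT.
have t5 : 0 <= 5 * T by rewrite mulr_ge0.
have t6 : 0 <= 6 * T by rewrite mulr_ge0.
have t11 : 5 * T + 6 * T = 11 * T by ring.
have [small|] := pselect (forall x y, x != y -> indep_flow (m (5 * T)) (6 * T) x y <= 3 / 32).
  by exists 11%N => // phi dphi phi01; exact: exch_solution_separate_mix.
move=> /existsNP[x0] /existsNP[y0] /not_implyP[xy0 /negP]; rewrite -ltNge => big.
exists 528%N => // phi dphi phi01 x y x' y' xy xy'.
have t528 : 0 <= 528 * T by rewrite mulr_ge0.
(* Six periods change the expectation of [m (5 * T)] by at most 1/32 between starting pairs, so one
   pair above 3/32 puts all pairs above 1/16. *)
have h11 z z' : z != z' -> h (11 * T) z z' <= 15 / 16.
  move=> zz'; have := indep_flow_meeting_le t6 t5 zz'; rewrite t11 /m.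
  have e64 : 2 ^+ 6 = 64 :> R by ring.
  have := indep_flow_mix 6 V0 T0 mixT (fun x y => m01 x y t5) x0 y0 z z'.
  by rewrite e64; lra.
have h528 z z' : z != z' -> h (528 * T) z z' <= 1 / 8.
  move=> zz'; have t11' : 0 <= 11 * T by rewrite mulr_ge0.
  have a0 : 0 <= 15 / 16 :> R by lra.
  have := nonmeeting_iter t11' a0 h11 48 zz'.
  rewrite mulrA (_ : 48 * 11 = 528 :> R); last by rewrite -natrM.
  move=> /le_trans; apply.
  (* The power is bounded in stages, through 4/5 to the power 12, to keep the numbers small. *)
  have -> : (15 / 16) ^+ 48 = ((15 / 16) ^+ 4) ^+ 12 :> R by rewrite -exprM.
  have b1 : (15 / 16) ^+ 4 <= 4 / 5 :> R by lra.
  have b0 : 0 <= (15 / 16) ^+ 4 :> R by lra.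
  apply: le_trans (lerXn2r 12 b0 _ b1) _; first by rewrite nnegrE; lra.
  have -> : (4 / 5) ^+ 12 = ((4 / 5) ^+ 3) ^+ 4 :> R by rewrite -exprM.
  lra.
have -> : 1 / 4 = 2 * (1 / 8) :> R by lra.
exact: exch_solution_meeting_mix.
Qed.

End Comparisons.

(** * Mixing times *)

Lemma mixing_time_le (R : realType) (S : finType) (rate : S -> S -> R) (eps t : R) :
  0 <= t -> worst_dTV rate t <= eps -> (mixing_time rate eps <= t%:E)%E.
Proof. by move=> t0 mixt; apply: ereal_inf_lbound; exists t. Qed.

(** Reduces the theorem to a bound at each time when the walk is mixed; the infimum need not be
    attained and the set may be empty. *)
Lemma le_mul_ereal_inf (R : realType) (c : R) (x : \bar R) (A : set R) : 0 < c ->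
  (forall t, A t -> (x <= (c * t)%:E)%E) ->
  (x <= c%:E * ereal_inf [set t%:E | t in A])%E.
Proof.
move=> c0 xA; rewrite -lee_pdivrMl //.
apply: le_ereal_inf_tmp => _ [t At <-].
by rewrite lee_pdivrMl // -EFinM xA.
Qed.

Lemma pair2_flow_solution (R : realType) (G : wgraph R)
    (f : pair2 (vertex G) -> R) :
  exists2 phi : R -> vertex G -> vertex G -> R, exch_solution phi &
  forall t (z : pair2 (vertex G)), phi t (val z).1 (val z).2 =
    flow (edge G) (@weight R G) (fun e => pair2_move (edge_swap e)) f t z.
Proof.
pose fl := flow (edge G) (@weight R G) (fun e => pair2_move (edge_swap e)) f.
(* The default 0 on the diagonal is never read, as swaps keep distinct vertices distinct. *)
pose phi t x y : R := if insub (x, y) is Some z then fl t z else 0.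
have phiE t (z : pair2 (vertex G)) : phi t (val z).1 (val z).2 = fl t z.
  by rewrite /phi -surjective_pairing valK.
exists phi => // s x y xy.
pose z : pair2 (vertex G) := exist _ (x, y) xy.
rewrite (_ : (fun s => phi s x y) = fun s => fl s z); last first.
  by apply/funext => r; rewrite -phiE.
apply: (is_derive_eq (is_derive_flow _ _ _ _ _ _)); apply: eq_bigr => e _.
have -> : phi s x y = fl s z by rewrite -phiE.
by have -> : phi s (edge_swap e x) (edge_swap e y) = fl s (pair2_move (edge_swap e) z)
  by rewrite -phiE.
Qed.

Theorem lemma1p1 (R : realType) (G : wgraph R)
    (connG : connected_graph G) (cardV : (2 <= #|vertex G|)%N) :
  (mixing_time (IP2 G) (1 / 4) <= 20000%:E * mixing_time (RW G) (1 / 4))%E.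
Proof.
apply: le_mul_ereal_inf => [|T [T0 mixT]]; first by rewrite ltr0n.
have V0 : (0 < #|vertex G|)%N := vertex_gt0 G.
have [h hP] := @nonmeeting_exists R G.
have [k k20000 mixk] := exch_solution_mix hP V0 T0 mixT.
(* Mixing at the single time [k%:R * T] already bounds the infimum. *)
apply: (@le_trans _ _ (k%:R * T)%:E); last first.
  by rewrite lee_fin ler_wpM2r // ler_nat.
have kT0 : 0 <= k%:R * T by rewrite mulr_ge0.
apply: mixing_time_le => //.
have pair0 : (0 < #|{: pair2 (vertex G)}|)%N.
  have /card_gt1P[x [y [_ _ xy]]] : (1 < #|[set: vertex G]%SET|)%N by rewrite cardsT.
  by apply/card_gt0P; exists (exist _ (x, y) xy).
apply: worst_dTV_le => // [e|f f01 z z']; first exact: pair2_move_inj.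
have [phi dphi phiE] := pair2_flow_solution f.
rewrite -!phiE; apply: mixk => //; [|exact: (valP z)|exact: (valP z')].
move=> x y xy; rewrite -[x]/(val (exist _ (x, y) xy : pair2 (vertex G))).1.
rewrite -[y in phi _ _ y]/(val (exist _ (x, y) xy : pair2 (vertex G))).2.
by rewrite phiE flow0.
Qed.
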